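(* $\tau_{pp}$ is the unique topology $\tau$ on $I(\mathbb N)$ such that: $(I(\mathbb N),\tau)$ is a Polish topological inverse semigroup, the set of idempotents $\{1_A: A\subseteq\mathbb N\}$ is $\tau$-compact, and for every $A\subseteq\mathbb N$ the map $r_A:I(\mathbb N)\to R_A$, $r_A(f)=f\circ 1_A$, is open, where $R_A=\{f\circ 1_A: f\in I(\mathbb N)\}$ carries the subspace topology of $\tau$. That is, $\tau_{pp}$ has these properties, and any topology $\tau$ with these properties equals $\tau_{pp}$.
   Context: $I(\mathbb N)$ is the set of all bijections $f:B\to C$ with $B,C\subseteq\mathbb N$ (including the empty map), $\mathrm{dom}(f)=B$, $\mathrm{im}(f)=C$, with composition $\mathrm{dom}(f\circ g)=g^{-1}(\mathrm{dom}(f)\cap\mathrm{im}(g))$, $(f\circ g)(x)=f(g(x))$, and inversion $f\mapsto f^{-1}$. $1_A$ is the identity on $A$; these are the idempotents. For $x,y\in\mathbb N$: $v(x,y)=\{f: x\in\mathrm{dom}(f), f(x)=y\}$, $w_1(x)=\{f: x\notin\mathrm{dom}(f)\}$, $w_2(y)=\{f: y\notin\mathrm{im}(f)\}$; $\tau_{pp}$ is the topology generated by the subbasis of all these sets. A topological inverse semigroup has continuous multiplication and inversion. *)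

(* Defs.v *)
From Stdlib Require Import Reals List Classical ClassicalEpsilon.
Open Scope R_scope.

Definition pinj (f : nat -> option nat) : Prop :=
  forall x y z, f x = Some z -> f y = Some z -> x = y.

Definition IN : Type := { f : nat -> option nat | pinj f }.

Definition app (f : IN) : nat -> option nat := proj1_sig f.

Definition comp_fun (f g : nat -> option nat) (x : nat) : option nat :=
  match g x with Some y => f y | None => None end.

Lemma comp_pinj (f g : IN) : pinj (comp_fun (app f) (app g)).
Proof.
  destruct f as [f Hf], g as [g Hg]; unfold pinj, comp_fun, app; simpl.
  intros x y z Hx Hy.
  destruct (g x) as [a|] eqn:E1; [|discriminate].
  destruct (g y) as [b|] eqn:E2; [|discriminate].
  assert (a = b) by (eapply Hf; eauto). subst b.
  eapply Hg; eauto.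
Qed.

Definition comp (f g : IN) : IN := exist _ _ (comp_pinj f g).

Definition inv_fun (f : IN) (y : nat) : option nat :=
  match excluded_middle_informative (exists x, app f x = Some y) with
  | left H => Some (proj1_sig (constructive_indefinite_description _ H))
  | right _ => None
  end.

Lemma inv_pinj (f : IN) : pinj (inv_fun f).
Proof.
  unfold pinj, inv_fun; intros y1 y2 x H1 H2.
  destruct (excluded_middle_informative (exists x, app f x = Some y1)) as [e1|];
    [|discriminate].
  destruct (excluded_middle_informative (exists x, app f x = Some y2)) as [e2|];
    [|discriminate].
  destruct (constructive_indefinite_description _ e1) as [a Ha].
  destruct (constructive_indefinite_description _ e2) as [b Hb].
  simpl in *. injection H1 as ->. injection H2 as ->.
  rewrite Ha in Hb. injection Hb as Hb. exact Hb.
Qed.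

Definition inv (f : IN) : IN := exist _ _ (inv_pinj f).

Definition id_fun (A : nat -> Prop) (x : nat) : option nat :=
  if excluded_middle_informative (A x) then Some x else None.

Lemma id_pinj (A : nat -> Prop) : pinj (id_fun A).
Proof.
  unfold pinj, id_fun; intros x y z Hx Hy.
  destruct (excluded_middle_informative (A x)); [|discriminate].
  destruct (excluded_middle_informative (A y)); [|discriminate].
  congruence.
Qed.

Definition one (A : nat -> Prop) : IN := exist _ _ (id_pinj A).

Definition is_topology {T : Type} (O : (T -> Prop) -> Prop) : Prop :=
  O (fun _ => True) /\
  (forall F : (T -> Prop) -> Prop,
      (forall U, F U -> O U) -> O (fun x => exists U, F U /\ U x)) /\
  (forall U V, O U -> O V -> O (fun x => U x /\ V x)).

Definition generated {T : Type} (S : (T -> Prop) -> Prop) (U : T -> Prop) : Prop :=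
  forall O, is_topology O -> (forall V, S V -> O V) -> O U.

Definition prod_top {T1 T2 : Type} (O1 : (T1 -> Prop) -> Prop)
  (O2 : (T2 -> Prop) -> Prop) : ((T1 * T2) -> Prop) -> Prop :=
  generated (fun W => exists U V, O1 U /\ O2 V /\
                        forall p, W p <-> (U (fst p) /\ V (snd p))).

Definition continuous {T1 T2 : Type} (O1 : (T1 -> Prop) -> Prop)
  (O2 : (T2 -> Prop) -> Prop) (g : T1 -> T2) : Prop :=
  forall U, O2 U -> O1 (fun x => U (g x)).

Definition compact_in {T : Type} (O : (T -> Prop) -> Prop) (K : T -> Prop) : Prop :=
  forall F : (T -> Prop) -> Prop,
    (forall U, F U -> O U) ->
    (forall x, K x -> exists U, F U /\ U x) ->
    exists l : list (T -> Prop),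
      (forall U, In U l -> F U) /\ (forall x, K x -> exists U, In U l /\ U x).

Definition is_metric {T : Type} (d : T -> T -> R) : Prop :=
  (forall x y, 0 <= d x y) /\
  (forall x y, d x y = 0 <-> x = y) /\
  (forall x y, d x y = d y x) /\
  (forall x y z, d x z <= d x y + d y z).

Definition metric_top {T : Type} (d : T -> T -> R) (U : T -> Prop) : Prop :=
  forall x, U x -> exists eps, 0 < eps /\ forall y, d x y < eps -> U y.

Definition metric_complete {T : Type} (d : T -> T -> R) : Prop :=
  forall u : nat -> T,
    (forall eps, 0 < eps -> exists N, forall m n, (N <= m)%nat -> (N <= n)%nat ->
       d (u m) (u n) < eps) ->
    exists l, forall eps, 0 < eps -> exists N, forall n, (N <= n)%nat -> d (u n) l < eps.

Definition separable {T : Type} (O : (T -> Prop) -> Prop) : Prop :=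
  exists D : T -> Prop,
    (exists e : nat -> T, forall x, D x -> exists n, e n = x) /\
    (forall U, O U -> (exists x, U x) -> exists x, D x /\ U x).

Definition polish {T : Type} (O : (T -> Prop) -> Prop) : Prop :=
  is_topology O /\ separable O /\
  exists d : T -> T -> R, is_metric d /\ metric_complete d /\
    (forall U, O U <-> metric_top d U).

Definition v_set (x y : nat) (f : IN) : Prop := app f x = Some y.
Definition w1_set (x : nat) (f : IN) : Prop := app f x = None.
Definition w2_set (y : nat) (f : IN) : Prop := ~ exists x, app f x = Some y.

Definition pp_subbasis (U : IN -> Prop) : Prop :=
  (exists x y, U = v_set x y) \/ (exists x, U = w1_set x) \/ (exists y, U = w2_set y).

Definition tau_pp : (IN -> Prop) -> Prop := generated pp_subbasis.

Definition top_inverse_semigroup (O : (IN -> Prop) -> Prop) : Prop :=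
  continuous (prod_top O O) O (fun p => comp (fst p) (snd p)) /\
  continuous O O inv.

Definition idempotents (f : IN) : Prop := exists A : nat -> Prop, f = one A.

Definition R_set (A : nat -> Prop) (g : IN) : Prop := exists f, g = comp f (one A).

(* r_A : I(N) -> R_A, f |-> f o 1_A, is open when R_A carries the subspace
   topology: images of open sets are traces on R_A of open sets. *)
Definition r_open (O : (IN -> Prop) -> Prop) (A : nat -> Prop) : Prop :=
  forall U, O U ->
    exists V, O V /\
      forall g, (exists f, U f /\ g = comp f (one A)) <-> (V g /\ R_set A g).

Definition good_topology (O : (IN -> Prop) -> Prop) : Prop :=
  is_topology O /\ polish O /\ top_inverse_semigroup O /\
  compact_in O idempotents /\
  (forall A : nat -> Prop, r_open O A).

(* Main.v *)
(** A topology O as in the theorem refines [tau_pp]: every subbasic set is the set of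
    solutions of an inequation between words in f and f^-1, hence O-open.
    For the converse, compare the two topologies on the group of units first.  By the
    Baire category theorem for [tau_pp] and O-separability, the identity from O to
    [tau_pp] is nearly open on the units; as O is completely metrizable, a nearly open
    continuous bijection is open (Byczkowski-Pol), so the topologies agree there.
    Finally every s is a compression phi^-1 t(s) phi of its Halmos dilation t(s), a
    permutation depending [tau_pp]-continuously on s, and t |-> phi^-1 t phi is
    O-continuous, which carries the agreement over to all of I(N).  *)

Require Import Defs.
From Stdlib Require Import Reals List Classical ClassicalEpsilon.
From Stdlib Require Import Lra Lia.
From Stdlib Require Import FunctionalExtensionality PropExtensionality.
From Stdlib Require Cantor.
(* [app] from [List] must not hide the one of [Defs]. *)
Import Defs.

(** * Metric spaces *)

(** The obstacle is the lack of inverses: Baire category gives information near one unknown point,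
    and it takes a group to translate it to every other point. Hence the detour through the units;
    being cut out by equations, they are closed for [O], and so completely metrizable again. The
    dilation needs continuity for [tau_pp] only, where it can be checked by hand, and the way back
    is a product with constant factors, continuous for [O] by assumption. The two complete metrics
    have separate duties: that of [tau_pp] feeds Baire's theorem, that of [O] provides the limits
    that turn near openness into openness. *)

Lemma dependent_choice {S : Type} (R : nat -> S -> S -> Prop) (s0 : S) :
  (forall n s, exists s', R n s s') ->
  exists u : nat -> S, u O = s0 /\ forall n, R n (u n) (u (Datatypes.S n)).
Proof.
  intros H.
  pose (f n s := proj1_sig (constructive_indefinite_description _ (H n s))).
  exists (nat_rect (fun _ => S) s0 f); split; [reflexivity|].
  intros n; cbn; unfold f at 1.
  exact (proj2_sig (constructive_indefinite_description _ (H n _))).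
Qed.

Lemma pos_below (a b c : R) :
  0 < a -> 0 < b -> 0 < c -> exists r, 0 < r /\ r <= a /\ r <= b /\ r <= c.
Proof.
  intros; exists (Rmin a (Rmin b c)).
  pose proof (Rmin_l a (Rmin b c)); pose proof (Rmin_r a (Rmin b c)).
  pose proof (Rmin_l b c); pose proof (Rmin_r b c).
  repeat split; try lra; repeat apply Rmin_pos; auto.
Qed.

Lemma inv_S_pos (n : nat) : 0 < / INR (S n).
Proof. apply Rinv_0_lt_compat, lt_0_INR; lia. Qed.

Lemma inv_S_le (m n : nat) : (m <= n)%nat -> / INR (S n) <= / INR (S m).
Proof.
  intros; apply Rinv_le_contravar; [apply lt_0_INR; lia|apply le_INR; lia].
Qed.

Lemma inv_S_below (eps : R) : 0 < eps -> exists n, / INR (S n) < eps.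
Proof.
  intros H; destruct (archimed_cor1 eps H) as [[|n] [Hn Hp]]; [lia|eauto].
Qed.

Definition metric_cont {T T' : Type} (d : T -> T -> R) (d' : T' -> T' -> R)
  (F : T -> T') : Prop :=
  forall x eps, 0 < eps ->
    exists delta, 0 < delta /\ forall y, d x y < delta -> d' (F x) (F y) < eps.

Definition metric_cont2 {T : Type} (d : T -> T -> R) (m : T -> T -> T) : Prop :=
  forall x y eps, 0 < eps ->
    exists delta, 0 < delta /\
      forall x' y', d x x' < delta -> d y y' < delta -> d (m x y) (m x' y') < eps.

Section MetricFacts.
Context {T : Type} (d : T -> T -> R) (Hd : is_metric d).

Lemma metric_ge0 x y : 0 <= d x y.
Proof. apply Hd. Qed.

Lemma metric_refl x : d x x = 0.
Proof. now apply Hd. Qed.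

Lemma metric_sym x y : d x y = d y x.
Proof. apply Hd. Qed.

Lemma metric_triangle x y z : d x z <= d x y + d y z.
Proof. apply Hd. Qed.

Lemma metric_pos x y : x <> y -> 0 < d x y.
Proof.
  intros H; destruct (Rtotal_order 0 (d x y)) as [|[E|]]; auto.
  - destruct H; apply Hd; auto.
  - pose proof (metric_ge0 x y); lra.
Qed.

Lemma metric_top_ball x eps : metric_top d (fun y => d x y < eps).
Proof.
  intros y Hy; exists (eps - d x y); split; [lra|].
  intros z Hz; pose proof (metric_triangle x y z); lra.
Qed.

Lemma metric_top_neq x : metric_top d (fun y => y <> x).
Proof.
  intros y Hy; exists (d y x); split; [now apply metric_pos|].
  intros z Hz ->; lra.
Qed.

Lemma metric_cont2_comp {T' : Type} (d' : T' -> T' -> R) (m : T -> T -> T) F G :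
  metric_cont2 d m -> metric_cont d' d F -> metric_cont d' d G ->
  metric_cont d' d (fun x => m (F x) (G x)).
Proof.
  intros Hm HF HG x eps Heps.
  destruct (Hm (F x) (G x) eps Heps) as [e [He H]].
  destruct (HF x e He) as [e1 [He1 H1]], (HG x e He) as [e2 [He2 H2]].
  destruct (pos_below e1 e2 1) as [r [? [? [? ?]]]]; try lra.
  exists r; split; auto; intros y Hy; apply H; [apply H1|apply H2]; lra.
Qed.

Lemma metric_cont_const {T' : Type} (d' : T' -> T' -> R) (c : T) :
  metric_cont d' d (fun _ => c).
Proof.
  intros x eps Heps; exists 1; split; [lra|]; intros; now rewrite metric_refl.
Qed.

(** The strict inequality puts the closed ball at [S n] inside the open ball at [n]: passing to the
    limit only gives [<=] at [S n], which is still [<] at [n]. *)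
Lemma nested_balls (c : nat -> T) (r : nat -> R) :
  metric_complete d ->
  (forall n, 0 < r n <= / INR (S n)) ->
  (forall n, d (c n) (c (S n)) + r (S n) < r n) ->
  exists l, forall n, d (c n) l < r n.
Proof.
  intros Hc Hr Hn.
  assert (Hnk : forall n k, d (c n) (c (k + n)%nat) + r (k + n)%nat <= r n).
  { intros n k; induction k as [|k IH]; simpl plus; [rewrite metric_refl; lra|].
    pose proof (metric_triangle (c n) (c (k + n)%nat) (c (S (k + n)))).
    specialize (Hn (k + n)%nat); lra. }
  assert (Hnm : forall n m, (n <= m)%nat -> d (c n) (c m) < r n).
  { intros n m Hm; specialize (Hnk n (m - n)%nat).
    replace (m - n + n)%nat with m in Hnk by lia.
    specialize (Hr m); lra. }
  destruct (Hc c) as [l Hl].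
  { intros eps Heps; destruct (inv_S_below (eps / 2)) as [N HN]; [lra|].
    exists N; intros m n Hm Hn'.
    pose proof (Hnm N m Hm); pose proof (Hnm N n Hn'); pose proof (Hr N).
    pose proof (metric_triangle (c m) (c N) (c n)).
    rewrite (metric_sym (c m) (c N)) in *; lra. }
  exists l.
  assert (Hle : forall n, d (c n) l <= r n).
  { intros n; apply Rnot_lt_le; intros Hlt.
    destruct (Hl (d (c n) l - r n)) as [N HN]; [lra|].
    specialize (HN (max n N) ltac:(lia)).
    pose proof (Hnm n (max n N) ltac:(lia)).
    pose proof (metric_triangle (c n) (c (max n N)) l); lra. }
  intros n; pose proof (metric_triangle (c n) (c (S n)) l).
  specialize (Hle (S n)); specialize (Hn n); lra.
Qed.

(** If every [A n] were nowhere dense, each ball would contain a smaller one whose centre keeps a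
    distance of at least the new radius from [A n]; the limit of these balls would lie in no [A n].
    The sets are not assumed closed, so the conclusion is density in a ball. *)
Lemma baire (A : nat -> T -> Prop) (x0 : T) :
  metric_complete d -> (forall x, exists n, A n x) ->
  exists n x eps, 0 < eps /\
    forall y, d x y < eps -> forall eta, 0 < eta -> exists z, A n z /\ d y z < eta.
Proof.
  intros Hc Hcov; apply NNPP; intros Hno.
  pose (St := { p : T * R | 0 < snd p }).
  pose (step n (s s' : St) :=
    let (x, r) := proj1_sig s in let (y, r') := proj1_sig s' in
    d x y + r' < r /\ r' <= / INR (S (S n)) /\ forall z, A n z -> r' <= d y z).
  destruct (dependent_choice step (exist _ (x0, 1) Rlt_0_1)) as [u [H0 Hu]].
  { intros n [[x r] Hr]; simpl in Hr.
    assert (H : exists y eta, d x y < r /\ 0 < eta /\ forall z, A n z -> eta <= d y z).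
    { apply NNPP; intros H; apply Hno; exists n, x, r; split; auto.
      intros y Hy eta Heta; apply NNPP; intros Hz; apply H.
      exists y, eta; repeat split; auto; intros z HA.
      apply Rnot_lt_le; intros Hlt; apply Hz; eauto. }
    destruct H as [y [eta [Hy [Heta Hz]]]].
    destruct (pos_below eta ((r - d x y) / 2) (/ INR (S (S n))))
      as [r' [Hr' [? [? ?]]]]; auto using inv_S_pos; [lra|].
    exists (exist _ (y, r') Hr'); simpl; repeat split; [lra|auto|].
    intros z HA; specialize (Hz z HA); lra. }
  destruct (nested_balls (fun n => fst (proj1_sig (u n)))
              (fun n => snd (proj1_sig (u n)))) as [l Hl]; auto.
  - intros [|n]; [rewrite H0; simpl; lra|].
    specialize (Hu n); unfold step in Hu.
    destruct (u n) as [[x r] Hr], (u (S n)) as [[y r'] Hr'].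
    simpl proj1_sig in *; cbn [fst snd] in *; split; [auto|apply Hu].
  - intros n; specialize (Hu n); unfold step in Hu.
    destruct (u n) as [[x r] Hr], (u (S n)) as [[y r'] Hr']; apply Hu.
  - destruct (Hcov l) as [n Hn]; specialize (Hu n); specialize (Hl (S n)).
    unfold step in Hu; destruct (u n) as [[x r] Hr], (u (S n)) as [[y r'] Hr'].
    simpl in *; destruct Hu as [_ [_ Hu]]; specialize (Hu l Hn); lra.
Qed.

(** A dense sequence may avoid [P] altogether. So a point of [P] is chosen in each ball of radius
    1/(k+1) about [q n] that meets [P], the pairs (n, k) being coded by one number; [x0] fills the
    slots of the other balls. *)
Lemma subspace_dense_seq (q : nat -> T) (P : T -> Prop) (x0 : { x | P x }) :
  (forall x eps, 0 < eps -> exists n, d x (q n) < eps) ->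
  exists q' : nat -> { x | P x },
    forall (x : { x | P x }) eps, 0 < eps ->
      exists n, d (proj1_sig x) (proj1_sig (q' n)) < eps.
Proof.
  intros Hq.
  assert (Hch : forall j, exists y : { x | P x }, let (n, k) := Cantor.of_nat j in
            (exists z, P z /\ d (q n) z < / INR (S k)) ->
            d (q n) (proj1_sig y) < / INR (S k)).
  { intros j; destruct (Cantor.of_nat j) as [n k].
    destruct (classic (exists z, P z /\ d (q n) z < / INR (S k))) as [[z [Hz Hd']]|H].
    - now exists (exist _ z Hz).
    - exists x0; intros; contradiction. }
  exists (fun j => proj1_sig (constructive_indefinite_description _ (Hch j))).
  intros [x Hx] eps Heps; destruct (inv_S_below (eps / 2)) as [k Hk]; [lra|].
  destruct (Hq x (/ INR (S k)) (inv_S_pos k)) as [n Hn].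
  exists (Cantor.to_nat (n, k)).
  destruct (constructive_indefinite_description _ (Hch _)) as [y Hy]; simpl.
  rewrite Cantor.cancel_of_to in Hy.
  assert (d (q n) (proj1_sig y) < / INR (S k)).
  { apply Hy; exists x; rewrite metric_sym; auto. }
  pose proof (metric_triangle x (q n) (proj1_sig y)); lra.
Qed.
End MetricFacts.

Lemma metric_top_preimage {T T' : Type} (d : T -> T -> R) (d' : T' -> T' -> R)
  (F : T -> T') (U : T' -> Prop) :
  metric_cont d d' F -> metric_top d' U -> metric_top d (fun x => U (F x)).
Proof.
  intros HF HU x Hx; destruct (HU _ Hx) as [eps [Heps H]].
  destruct (HF x eps Heps) as [delta [Hdelta H']]; eauto.
Qed.

Lemma metric_cont_id {T : Type} (d : T -> T -> R) : metric_cont d d (fun x => x).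
Proof. intros x eps Heps; eauto. Qed.

Lemma is_topology_metric_top {T : Type} (d : T -> T -> R) :
  is_topology (metric_top d).
Proof.
  split; [|split].
  - intros x _; exists 1; split; [lra|auto].
  - intros F HF x [U [HU Hx]]; destruct (HF U HU x Hx) as [eps [Heps H]]; eauto 6.
  - intros U V HU HV x [Hx Hx'].
    destruct (HU x Hx) as [e [He H]], (HV x Hx') as [e' [He' H']].
    destruct (pos_below e e' 1) as [r [? [? [? ?]]]]; try lra.
    exists r; split; auto; intros y Hy; split; [apply H|apply H']; lra.
Qed.

(** * Near openness and the open mapping theorem for groups *)

(** Near openness of the identity asks this with [x] equal to [c]; the interlacing argument also
    needs it at points [x] other than the centre. *)
Definition interior_closure_ball {T : Type} (d1 d2 : T -> T -> R) (c : T) (r : R)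
  (x : T) : Prop :=
  exists delta, 0 < delta /\
    forall y, d2 x y < delta -> forall eta, 0 < eta -> exists z, d1 c z < r /\ d2 y z < eta.

(* Two sequences of shrinking [d1]-balls are interlaced so that each is
   [d2]-dense near the other; their limits coincide by uniqueness of [d2]-limits. *)
Lemma nearly_open_identity {T : Type} (d1 d2 : T -> T -> R) :
  is_metric d1 -> is_metric d2 -> metric_complete d1 ->
  metric_cont d1 d2 (fun x => x) ->
  (forall x eps, 0 < eps -> interior_closure_ball d1 d2 x eps x) ->
  metric_cont d2 d1 (fun x => x).
Proof.
  intros M1 M2 C1 Hfine Hno x eps Heps.
  destruct (pos_below (eps / 2) 1 1) as [r0 [Hr0 [Hr1 [Hr2 _]]]]; try lra.
  destruct (Hno x r0 Hr0) as [delta [Hdelta Hx]].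
  exists delta; split; auto; intros y Hy.
  (* Both balls have radius at most [eps / 2], so a common point suffices; it will be the common
     limit of the two sequences of centres. *)
  enough (H : exists p, d1 x p < r0 /\ d1 y p < r0).
  { destruct H as [p [H1 H2]]; pose proof (metric_triangle d1 M1 x p y).
    rewrite (metric_sym d1 M1 p y) in *; lra. }
  assert (Hnear : forall c r z e,
    (forall y, d2 z y < e -> forall eta, 0 < eta -> exists z, d1 c z < r /\ d2 y z < eta) ->
    forall w, d2 z w < e -> interior_closure_ball d1 d2 c r w).
  { intros c r z e H w Hw; exists (e - d2 z w); split; [lra|].
    intros w' Hw'; apply H; pose proof (metric_triangle d2 M2 z w w'); lra. }
  pose (St := { p : (T * R) * (T * R) |
    0 < snd (fst p) /\ 0 < snd (snd p) /\
    interior_closure_ball d1 d2 (fst (fst p)) (snd (fst p)) (fst (snd p)) }).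
  pose (step n (s s' : St) :=
    let '((v, rv), (g, rg)) := proj1_sig s in
    let '((v', rv'), (g', rg')) := proj1_sig s' in
    d1 v v' + rv' < rv /\ d1 g g' + rg' < rg /\
    rv' <= / INR (S (S n)) /\ rg' <= / INR (S (S n)) /\
    forall w, d1 v' w < rv' -> interior_closure_ball d1 d2 g rg w).
  assert (Hstep : forall n s, exists s', step n s s').
  { intros n [[[v rv] [g rg]] [Hrv [Hrg Hvg]]]; simpl in *.
    (* The [d2]-ball of radius [e] about [g] lies in the closure of the [d1]-ball about [g]. The
       invariant finds [v'] in it, and [e2] keeps the new ball about [v'] in it as well. Near
       openness at [v'] gives [e3], and a [g'] within [e3] of [v'] restores the invariant. *)
    destruct (Hno g rg Hrg) as [e [He Hg]].
    destruct Hvg as [e1 [He1 Hvg]].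
    destruct (Hvg g) with (eta := e) as [v' [Hv' Hgv']]; auto.
    { now rewrite metric_refl. }
    destruct (Hfine v' (e - d2 g v')) as [e2 [He2 Hv'e]]; [lra|].
    destruct (pos_below e2 ((rv - d1 v v') / 2) (/ INR (S (S n))))
      as [rv' [Hrv' [Hle1 [Hle2 Hle3]]]]; auto using inv_S_pos; [lra|].
    destruct (Hno v' rv' Hrv') as [e3 [He3 Hcl]].
    destruct (Hnear g rg g e Hg v' Hgv') as [e4 [He4 Hgcl]].
    destruct (Hgcl v') with (eta := e3) as [g' [Hg' Hvg']]; auto.
    { now rewrite metric_refl. }
    destruct (pos_below ((rg - d1 g g') / 2) (/ INR (S (S n))) 1)
      as [rg' [Hrg' [Hle4 [Hle5 _]]]]; auto using inv_S_pos; [lra|lra|].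
    unshelve eexists (exist _ ((v', rv'), (g', rg')) _).
    { simpl; eauto. }
    unfold step; simpl proj1_sig; cbv beta iota.
    split; [lra|]; split; [lra|]; split; [auto|]; split; [auto|].
    intros w Hw; apply (Hnear g rg g e Hg).
    specialize (Hv'e w ltac:(lra)); pose proof (metric_triangle d2 M2 g v' w); lra. }
  assert (H0 : 0 < r0 /\ 0 < r0 /\ interior_closure_ball d1 d2 x r0 y)
    by (repeat split; eauto).
  destruct (dependent_choice step (exist _ ((x, r0), (y, r0)) H0) Hstep)
    as [u [Hu0 Hu]].
  pose (V n := fst (proj1_sig (u n))); pose (G n := snd (proj1_sig (u n))).
  assert (HVG : forall n,
    d1 (fst (V n)) (fst (V (S n))) + snd (V (S n)) < snd (V n) /\
    d1 (fst (G n)) (fst (G (S n))) + snd (G (S n)) < snd (G n) /\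
    snd (V (S n)) <= / INR (S (S n)) /\ snd (G (S n)) <= / INR (S (S n)) /\
    forall w, d1 (fst (V (S n))) w < snd (V (S n)) ->
      interior_closure_ball d1 d2 (fst (G n)) (snd (G n)) w).
  { intros n; specialize (Hu n); unfold step in Hu; unfold V, G.
    destruct (proj1_sig (u n)) as [[v rv] [g rg]].
    destruct (proj1_sig (u (S n))) as [[v' rv'] [g' rg']]; exact Hu. }
  assert (Hpos : forall n, 0 < snd (V n) /\ 0 < snd (G n)).
  { intros n; unfold V, G; destruct (proj2_sig (u n)) as [? [? _]]; auto. }
  assert (HV0 : V O = (x, r0)) by (unfold V; now rewrite Hu0).
  assert (HG0 : G O = (y, r0)) by (unfold G; now rewrite Hu0).
  assert (HrG : forall n, snd (G n) <= / INR (S n)).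
  { intros [|n]; [rewrite HG0; simpl; lra|apply HVG]. }
  destruct (nested_balls d1 M1 (fun n => fst (V n)) (fun n => snd (V n)) C1)
    as [p Hp].
  { intros n; split; [apply Hpos|].
    destruct n; [rewrite HV0; simpl; lra|apply HVG]. }
  { intros n; apply HVG. }
  destruct (nested_balls d1 M1 (fun n => fst (G n)) (fun n => snd (G n)) C1)
    as [q Hq].
  { intros n; split; [apply Hpos|apply HrG]. }
  { intros n; apply HVG. }
  exists p; split; [specialize (Hp O); now rewrite HV0 in Hp|].
  (* If the limits differed, the [d1]-ball about [fst (G n)] would for large [n] be [d2]-close to
     [q], yet its [d2]-closure contains [p]. *)
  destruct (classic (p = q)) as [->|Hpq];
    [specialize (Hq O); now rewrite HG0 in Hq|exfalso].
  apply (metric_pos d2 M2) in Hpq.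
  destruct (Hfine q (d2 p q / 2)) as [e [He Hqe]]; [lra|].
  destruct (inv_S_below (e / 2)) as [n Hn]; [lra|].
  destruct (HVG n) as [_ [_ [_ [_ Hcl]]]].
  destruct (Hcl p (Hp (S n))) as [e' [He' Hpcl]].
  destruct (Hpcl p) with (eta := d2 p q / 2) as [z [Hz Hpz]]; [|lra|].
  { now rewrite metric_refl. }
  specialize (Hq n); specialize (HrG n); cbv beta in Hq.
  assert (Hqz : d2 q z < d2 p q / 2).
  { apply Hqe; pose proof (metric_triangle d1 M1 q (fst (G n)) z).
    rewrite (metric_sym d1 M1 q (fst (G n))) in *; lra. }
  pose proof (metric_triangle d2 M2 p z q); rewrite (metric_sym d2 M2 z q) in *; lra.
Qed.

(** For a small [d1]-ball V about [e], the translates V q_n cover the group, so by Baire in [d2] one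
    of them is dense in some [d2]-ball. Translating back by the inverse of one of its points, and
    then by [x], shows that x V V^-1 is [d2]-dense near [x]; V is chosen so that this set lies in
    the [eps]-ball about [x]. This is near openness. *)
Lemma group_open_mapping {T : Type} (m : T -> T -> T) (i : T -> T) (e : T)
  (d1 d2 : T -> T -> R) (q : nat -> T) :
  (forall x y z, m x (m y z) = m (m x y) z) ->
  (forall x, m e x = x) -> (forall x, m x e = x) ->
  (forall x, m x (i x) = e) -> (forall x, m (i x) x = e) ->
  is_metric d1 -> is_metric d2 -> metric_complete d1 -> metric_complete d2 ->
  (forall x eps, 0 < eps -> exists n, d1 x (q n) < eps) ->
  metric_cont2 d1 m -> metric_cont d1 d1 i -> metric_cont2 d2 m ->
  metric_cont d1 d2 (fun x => x) ->
  metric_cont d2 d1 (fun x => x).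
Proof.
  intros Hassoc Hel Her Hir Hil M1 M2 C1 C2 Hq Hm1 Hi1 Hm2 Hfine.
  apply nearly_open_identity; auto; intros x eps Heps.
  assert (Hii : i e = e) by (rewrite <- (Hel (i e)); apply Hir).
  assert (HV : exists r, 0 < r /\ forall a b, d1 e a < r -> d1 e b < r ->
                 d1 x (m x (m a (i b))) < eps).
  { destruct (Hm1 x e eps Heps) as [r1 [Hr1 H1]].
    destruct (Hm1 e e r1 Hr1) as [r2 [Hr2 H2]].
    destruct (Hi1 e r2 Hr2) as [r3 [Hr3 H3]].
    destruct (pos_below r2 r3 1) as [r [Hr [? [? _]]]]; try lra.
    exists r; split; auto; intros a b Ha Hb.
    rewrite <- (Her x) at 1; apply H1; [now rewrite metric_refl|].
    rewrite <- (Hel e) at 1; apply H2; [lra|].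
    rewrite <- Hii; apply H3; lra. }
  destruct HV as [r [Hr HV]].
  destruct (baire d2 M2 (fun n g => exists a, d1 e a < r /\ g = m a (q n)) e C2)
    as [n [y [e0 [He0 Hcl]]]].
  { intros g.
    (* The map w |-> g w^-1 is [d1]-continuous with value [e] at [g], so g q_n^-1 lies in V as soon
       as [q n] is close to [g]. *)
    destruct (metric_cont2_comp d1 d1 m (fun _ => g) i Hm1
                (metric_cont_const d1 M1 d1 g) Hi1 g r Hr) as [r' [Hr' H]].
    destruct (Hq g r' Hr') as [n Hn]; exists n, (m g (i (q n))); split.
    - rewrite <- (Hir g); auto.
    - now rewrite <- Hassoc, Hil, Her. }
  (* The centre [y] need not belong to V q_n, so a nearby point z = b q_n is inverted instead: then
     (a q_n) z^-1 = a b^-1 is in V V^-1. *)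
  destruct (Hcl y) with (eta := e0) as [z [[b [Hb Ez]] Hyz]]; auto.
  { now rewrite metric_refl. }
  set (k := m (i (q n)) (i b)).
  assert (Hzk : m z k = e).
  { unfold k; rewrite Ez, Hassoc, <- (Hassoc b), Hir, Her; apply Hir. }
  assert (Hkz : m k z = e).
  { unfold k; rewrite Ez, Hassoc, <- (Hassoc _ (i b)), Hil, Her; apply Hil. }
  assert (Hto : metric_cont d2 d2 (fun w => m x (m w k))).
  { apply metric_cont2_comp; auto using metric_cont_const.
    apply metric_cont2_comp; auto using metric_cont_const, metric_cont_id. }
  assert (Hfrom : metric_cont d2 d2 (fun w => m (m (i x) w) z)).
  { apply metric_cont2_comp; auto using metric_cont_const.
    apply metric_cont2_comp; auto using metric_cont_const, metric_cont_id. }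
  destruct (Hfrom x (e0 - d2 y z)) as [e1 [He1 H1]]; [lra|].
  exists e1; split; auto; intros y' Hy' eta Heta.
  specialize (H1 y' Hy'); rewrite Hil, Hel in H1.
  (* [w] is [y'] carried into the ball where V q_n is dense; w |-> x w z^-1 brings approximations of
     [w] back to [y']. *)
  set (w := m (m (i x) y') z) in *.
  assert (Hw : m x (m w k) = y').
  { unfold w; now rewrite <- (Hassoc _ z), Hzk, Her, Hassoc, Hir, Hel. }
  destruct (Hto w eta Heta) as [e2 [He2 H2]]; rewrite Hw in H2.
  destruct (Hcl w) with (eta := e2) as [w' [[a [Ha Ew']] Hww']]; auto.
  { pose proof (metric_triangle d2 M2 y z w); lra. }
  exists (m x (m w' k)); split; [|now apply H2].
  replace (m w' k) with (m a (i b)); [now apply HV|].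
  unfold k; rewrite Ew', Hassoc, <- (Hassoc a), Hir, Her; auto.
Qed.

(** * Partial injections *)

Lemma pred_ext {T : Type} (U V : T -> Prop) : (forall x, U x <-> V x) -> U = V.
Proof.
  intros H; apply functional_extensionality; intros x.
  now apply propositional_extensionality.
Qed.

Lemma option_ext {T : Type} (a b : option T) :
  (forall y, a = Some y <-> b = Some y) -> a = b.
Proof.
  destruct a as [x|]; intros H; [symmetry; now apply H|].
  destruct b as [y|]; auto; now apply H.
Qed.

Lemma IN_ext (f g : IN) :
  (forall x y, app f x = Some y <-> app g x = Some y) -> f = g.
Proof.
  intros H; assert (E : app f = app g).
  { apply functional_extensionality; intros x; apply option_ext; auto. }
  destruct f as [f Hf], g as [g Hg]; simpl in E; subst g.
  f_equal; apply proof_irrelevance.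
Qed.

Lemma app_inj (f : IN) x x' y : app f x = Some y -> app f x' = Some y -> x = x'.
Proof. exact (proj2_sig f x x' y). Qed.

Lemma app_inv (f : IN) x y : app (inv f) y = Some x <-> app f x = Some y.
Proof.
  simpl; unfold inv_fun; destruct (excluded_middle_informative _) as [H|H].
  - destruct (constructive_indefinite_description _ H) as [x' Hx']; simpl; split.
    + intros E; congruence.
    + intros E; f_equal; eapply app_inj; eauto.
  - split; [discriminate|intros E; destruct H; eauto].
Qed.

Lemma app_inv_None (f : IN) y :
  app (inv f) y = None <-> ~ exists x, app f x = Some y.
Proof.
  split.
  - intros E [x Hx]; rewrite <- app_inv in Hx; congruence.
  - intros H; destruct (app (inv f) y) as [x|] eqn:E; auto.
    rewrite app_inv in E; destruct H; eauto.
Qed.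

Lemma app_comp (f g : IN) x z :
  app (comp f g) x = Some z <-> exists y, app g x = Some y /\ app f y = Some z.
Proof.
  simpl; unfold comp_fun; destruct (app g x) as [y|]; split.
  - eauto.
  - intros [y' [E H]]; congruence.
  - discriminate.
  - intros [y' [E H]]; discriminate.
Qed.

Lemma app_one (A : nat -> Prop) x y : app (one A) x = Some y <-> A x /\ y = x.
Proof.
  simpl; unfold id_fun; destruct (excluded_middle_informative _); split.
  - intros E; split; congruence.
  - intros [_ ->]; auto.
  - discriminate.
  - tauto.
Qed.

Lemma comp_assoc (f g h : IN) : comp f (comp g h) = comp (comp f g) h.
Proof.
  apply IN_ext; intros x y; rewrite !app_comp; split.
  - intros [z [Hz Hy]]; apply app_comp in Hz as [w [Hw Hz]].
    exists w; rewrite app_comp; eauto.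
  - intros [w [Hw Hy]]; apply app_comp in Hy as [z [Hz Hy]].
    exists z; rewrite app_comp; eauto.
Qed.

Lemma inv_inv (f : IN) : inv (inv f) = f.
Proof. apply IN_ext; intros x y; now rewrite !app_inv. Qed.

Lemma inv_comp (f g : IN) : inv (comp f g) = comp (inv g) (inv f).
Proof.
  apply IN_ext; intros x y; rewrite app_inv, !app_comp.
  split; intros [z [H1 H2]]; exists z; rewrite !app_inv in *; auto.
Qed.

Lemma inv_one (A : nat -> Prop) : inv (one A) = one A.
Proof.
  apply IN_ext; intros x y; rewrite app_inv, !app_one.
  split; intros [? ->]; auto.
Qed.

Lemma app_comp_one (f : IN) (A : nat -> Prop) x y :
  app (comp f (one A)) x = Some y <-> A x /\ app f x = Some y.
Proof.
  rewrite app_comp; split.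
  - intros [z [Hz Hy]]; apply app_one in Hz as [HA ->]; auto.
  - intros [HA Hy]; exists x; rewrite app_one; auto.
Qed.

(** * Generated topologies, products and cylinders *)

Lemma is_topology_generated {T : Type} (S : (T -> Prop) -> Prop) :
  is_topology (generated S).
Proof.
  split; [|split].
  - intros O HO _; apply HO.
  - intros F HF O HO HS; apply HO; intros U HU; apply HF; auto.
  - intros U V HU HV O HO HS; apply HO; [apply HU|apply HV]; auto.
Qed.

Lemma is_topology_ext {T : Type} (O O' : (T -> Prop) -> Prop) :
  (forall U, O U <-> O' U) -> is_topology O -> is_topology O'.
Proof.
  intros H; enough (O = O') by (subst; auto); now apply pred_ext.
Qed.

Lemma open_local {T : Type} (O : (T -> Prop) -> Prop) (U : T -> Prop) :
  is_topology O ->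
  (forall x, U x -> exists V, O V /\ V x /\ forall y, V y -> U y) -> O U.
Proof.
  intros HO H.
  replace U with (fun x => exists V, (O V /\ forall y, V y -> U y) /\ V x).
  - apply HO; tauto.
  - apply pred_ext; intros x; split; [intros [V [[_ HV] Hx]]; auto|].
    intros Hx; destruct (H x Hx) as [V [? [? ?]]]; eauto.
Qed.

Lemma prod_top_iff {T1 T2 : Type} (O1 : (T1 -> Prop) -> Prop)
  (O2 : (T2 -> Prop) -> Prop) (W : T1 * T2 -> Prop) :
  is_topology O1 -> is_topology O2 ->
  prod_top O1 O2 W <->
  (forall a b, W (a, b) -> exists U V, O1 U /\ O2 V /\ U a /\ V b /\
     forall a' b', U a' -> V b' -> W (a', b')).
Proof.
  intros H1 H2; split.
  - intros HW; apply (HW (fun W => forall a b, W (a, b) -> exists U V,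
      O1 U /\ O2 V /\ U a /\ V b /\ forall a' b', U a' -> V b' -> W (a', b'))).
    + split; [|split].
      * intros a b _; exists (fun _ => True), (fun _ => True).
        repeat split; auto; [apply H1|apply H2].
      * intros F HF a b [W' [HW' Hab]].
        destruct (HF W' HW' a b Hab) as [U [V [? [? [? [? ?]]]]]].
        exists U, V; repeat split; eauto.
      * intros W1 W2 HW1 HW2 a b [Hab1 Hab2].
        destruct (HW1 a b Hab1) as [U [V [? [? [? [? ?]]]]]].
        destruct (HW2 a b Hab2) as [U' [V' [? [? [? [? ?]]]]]].
        exists (fun x => U x /\ U' x), (fun x => V x /\ V' x).
        split; [now apply H1|]; split; [now apply H2|].
        repeat split; auto; try tauto; firstorder.
    + intros W' [U [V [HU [HV HUV]]]] a b Hab; apply HUV in Hab.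
      exists U, V; repeat split; try tauto; intros; now apply HUV.
  - intros H; apply open_local; [apply is_topology_generated|].
    intros [a b] Hab; destruct (H a b Hab) as [U [V [HU [HV [Ha [Hb HUV]]]]]].
    exists (fun p => U (fst p) /\ V (snd p)); repeat split; auto.
    + intros O HO HS; apply HS; exists U, V; repeat split; auto; apply H0.
    + intros [a' b'] [? ?]; auto.
Qed.

(** The cylinders of [tau_pp]. Recording [inv f] as well accounts for [w2_set] and makes inversion
    an isometry of the metric below. *)
Definition agree (k : nat) (f g : IN) : Prop :=
  forall x, (x < k)%nat -> app f x = app g x /\ app (inv f) x = app (inv g) x.

Lemma agree_refl k f : agree k f f.
Proof. now split. Qed.

Lemma agree_sym k f g : agree k f g -> agree k g f.
Proof. intros H x Hx; destruct (H x Hx); auto. Qed.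

Lemma agree_trans k f g h : agree k f g -> agree k g h -> agree k f h.
Proof. intros H H' x Hx; destruct (H x Hx), (H' x Hx); split; congruence. Qed.

Lemma agree_le k m f g : (k <= m)%nat -> agree m f g -> agree k f g.
Proof. intros Hk H x Hx; apply H; lia. Qed.

Lemma agree_inv k f g : agree k f g -> agree k (inv f) (inv g).
Proof. intros H x Hx; rewrite !inv_inv; destruct (H x Hx); auto. Qed.

Lemma agree_all f g : (forall k, agree k f g) -> f = g.
Proof.
  intros H; apply IN_ext; intros x y; destruct (H (S x) x) as [E _]; [lia|].
  now rewrite E.
Qed.

Lemma tau_pp_cylinder k f : tau_pp (agree k f).
Proof.
  assert (Ht : is_topology tau_pp) by apply is_topology_generated.
  induction k as [|k IH].
  - replace (agree 0 f) with (fun _ : IN => True); [apply Ht|].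
    apply pred_ext; intros g; split; auto; intros _ x Hx; lia.
  - replace (agree (S k) f) with (fun g =>
      (app f k = app g k /\ app (inv f) k = app (inv g) k) /\ agree k f g).
    2:{ apply pred_ext; intros g; split.
        - intros [Hk H] x Hx; destruct (Nat.eq_dec x k) as [->|]; auto.
          apply H; lia.
        - intros H; split; [apply H; lia|intros x Hx; apply H; lia]. }
    apply Ht; auto; apply Ht.
    + intros O HO HS; apply HS; destruct (app f k) as [y|]; [left; exists k, y|].
      * apply pred_ext; intros g; unfold v_set; split; congruence.
      * right; left; exists k; apply pred_ext; intros g; unfold w1_set.
        split; congruence.
    + intros O HO HS; apply HS; destruct (app (inv f) k) as [y|].
      * left; exists y, k; apply pred_ext; intros g; unfold v_set.
        rewrite <- app_inv; split; congruence.
      * right; right; exists k; apply pred_ext; intros g; unfold w2_set.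
        rewrite <- app_inv_None; split; congruence.
Qed.

Lemma tau_pp_iff (U : IN -> Prop) :
  tau_pp U <-> forall f, U f -> exists k, forall g, agree k f g -> U g.
Proof.
  split.
  - intros HU; apply HU; clear U HU.
    + split; [|split].
      * exists O; auto.
      * intros F HF f [U [HU Hf]]; destruct (HF U HU f Hf) as [k Hk].
        exists k; eauto.
      * intros U V HU HV f [Hf Hf'].
        destruct (HU f Hf) as [k Hk], (HV f Hf') as [m Hm].
        exists (max k m); intros g Hg; split; [apply Hk|apply Hm];
          apply (agree_le _ (max k m)); auto; lia.
    + intros V [[x [y ->]]|[[x ->]|[y ->]]] f Hf.
      * exists (S x); intros g Hg; destruct (Hg x) as [E _]; [lia|].
        unfold v_set in *; congruence.
      * exists (S x); intros g Hg; destruct (Hg x) as [E _]; [lia|].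
        unfold w1_set in *; congruence.
      * exists (S y); intros g Hg; destruct (Hg y) as [_ E]; [lia|].
        unfold w2_set in *; rewrite <- app_inv_None in *; congruence.
  - intros H; apply open_local; [apply is_topology_generated|].
    intros f Hf; destruct (H f Hf) as [k Hk]; exists (agree k f).
    auto using tau_pp_cylinder, agree_refl.
Qed.

(** * A complete metric for the topology *)

(** At most one [n] qualifies, so the choice in [pp_dist] is harmless. The result is the usual
    ultrametric of a sequence space, applied to the pairs (f(n), f^-1(n)). *)
Definition first_difference (f g : IN) (n : nat) : Prop :=
  agree n f g /\ ~ agree (S n) f g.

Definition pp_dist (f g : IN) : R :=
  match excluded_middle_informative (exists n, first_difference f g n) with
  | left H => / INR (S (proj1_sig (constructive_indefinite_description _ H)))
  | right _ => 0
  end.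

Lemma pp_dist_spec f g :
  (f = g /\ pp_dist f g = 0) \/
  (exists n, first_difference f g n /\ pp_dist f g = / INR (S n)).
Proof.
  unfold pp_dist; destruct (excluded_middle_informative _) as [H|H].
  - right; destruct (constructive_indefinite_description _ H) as [n Hn]; eauto.
  - left; split; auto; apply agree_all; intros k; induction k as [|k IH].
    + intros x Hx; lia.
    + apply NNPP; intros Hk; apply H; exists k; split; auto.
Qed.

(** When the first difference is at [n], both sides say [k < n]; this is why agreement below [S k],
    not below [k], corresponds to the radius 1/(k+1). *)
Lemma pp_dist_lt f g k : pp_dist f g < / INR (S k) <-> agree (S k) f g.
Proof.
  destruct (pp_dist_spec f g) as [[-> ->]|[n [[Hn Hn'] ->]]]; split.
  - intros _; apply agree_refl.
  - intros _; apply inv_S_pos.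
  - intros H; apply (agree_le _ n); auto; apply Nat.nlt_ge; intros Hlt.
    pose proof (inv_S_le n k ltac:(lia)); lra.
  - intros H; assert (k < n)%nat.
    { apply Nat.nle_gt; intros Hle; apply Hn'; apply (agree_le _ (S k)); auto; lia. }
    apply Rinv_lt_contravar.
    + apply Rmult_lt_0_compat; apply lt_0_INR; lia.
    + apply lt_INR; lia.
Qed.

Lemma pp_dist_metric : is_metric pp_dist.
Proof.
  assert (Hge : forall f g, 0 <= pp_dist f g).
  { intros f g; destruct (pp_dist_spec f g) as [[_ ->]|[n [_ ->]]]; [lra|].
    apply Rlt_le, inv_S_pos. }
  assert (H0 : forall f, pp_dist f f = 0).
  { intros f; destruct (pp_dist_spec f f) as [[_ ->]|[n [[_ H] _]]]; auto.
    destruct H; apply agree_refl. }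
  assert (Hle : forall f g f' g',
    (forall k, agree k f' g' -> agree k f g) -> pp_dist f g <= pp_dist f' g').
  { intros f g f' g' H; destruct (pp_dist_spec f g) as [[_ ->]|[n [[_ Hn] ->]]]; auto.
    apply Rnot_lt_le; intros Hlt; apply Hn, H, pp_dist_lt; auto. }
  split; auto; split; [|split].
  - intros f g; split; [|intros ->; auto].
    destruct (pp_dist_spec f g) as [[-> _]|[n [_ ->]]]; auto.
    pose proof (inv_S_pos n); lra.
  - intros f g; apply Rle_antisym; apply Hle; auto using agree_sym.
  - intros f g h; destruct (pp_dist_spec f h) as [[_ ->]|[n [[_ Hn] ->]]].
    { pose proof (Hge f g); pose proof (Hge g h); lra. }
    (* Both summands would be below 1/(n+1), and agreement below [S n] is transitive. *)
    apply Rnot_lt_le; intros Hlt; apply Hn.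
    pose proof (Hge f g); pose proof (Hge g h).
    apply (agree_trans _ _ g); apply pp_dist_lt; lra.
Qed.

Lemma metric_top_pp_dist (U : IN -> Prop) : tau_pp U <-> metric_top pp_dist U.
Proof.
  rewrite tau_pp_iff; split.
  - intros H f Hf; destruct (H f Hf) as [k Hk].
    exists (/ INR (S k)); split; [apply inv_S_pos|].
    intros g Hg; apply Hk, (agree_le _ (S k)); [lia|]; now apply pp_dist_lt.
  - intros H f Hf; destruct (H f Hf) as [eps [Heps He]].
    destruct (inv_S_below eps Heps) as [k Hk]; exists (S k).
    intros g Hg; apply He; apply pp_dist_lt in Hg; lra.
Qed.

Lemma pp_dist_complete : metric_complete pp_dist.
Proof.
  intros u Hu.
  assert (HN : forall k, exists N, forall m n, (N <= m)%nat -> (N <= n)%nat ->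
                 agree k (u m) (u n)).
  { intros k; destruct (Hu (/ INR (S k)) (inv_S_pos k)) as [N HN].
    exists N; intros m n Hm Hn; apply (agree_le _ (S k)); [lia|].
    apply pp_dist_lt; auto. }
  pose (N k := proj1_sig (constructive_indefinite_description _ (HN k))).
  assert (HNk : forall k m n, (N k <= m)%nat -> (N k <= n)%nat ->
            agree k (u m) (u n)).
  { intros k; exact (proj2_sig (constructive_indefinite_description _ (HN k))). }
  clearbody N; clear HN Hu.
  pose (l x := app (u (N (S x))) x).
  assert (Hl : forall x n, (N (S x) <= n)%nat -> l x = app (u n) x).
  { intros x n Hn; apply (HNk (S x)); lia. }
  assert (Hlinj : pinj l).
  { intros x y z Hx Hy; pose (n := max (N (S x)) (N (S y))).
    rewrite (Hl x n) in Hx by lia; rewrite (Hl y n) in Hy by lia.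
    eapply app_inj; eauto. }
  exists (exist _ l Hlinj); intros eps Heps.
  destruct (inv_S_below eps Heps) as [k Hk]; exists (N (S k)); intros n Hn.
  enough (H : agree (S k) (u n) (exist _ l Hlinj))
    by (apply pp_dist_lt in H; lra).
  intros x Hx; split.
  - symmetry; simpl app; pose (m := max n (N (S x))).
    rewrite (Hl x m) by lia; apply (HNk (S k)); lia.
  (* The preimage [y] of [x] is not bounded by [k], so [l y] is read at a later stage [m] depending
     on [y]; the inverses of [u m] and [u n] already agree at [x]. *)
  - apply option_ext; intros y; pose (m := max n (N (S y))).
    rewrite app_inv with (f := exist _ l Hlinj).
    change (app (exist _ l Hlinj) y) with (l y).
    rewrite (Hl y m) by lia; rewrite <- (app_inv (u m)).
    now destruct (HNk (S k) n m Hn ltac:(lia) x Hx) as [_ ->].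
Qed.

(** Partial injections with finite graph are dense. A graph is coded by a list of pairs together
    with its length, which tells [dec] when to stop; codes of lists that are no such graph get an
    arbitrary value. *)
Lemma separable_tau_pp : separable tau_pp.
Proof.
  pose (dec := fix dec (k n : nat) : list (nat * nat) :=
    match k with
    | O => nil
    | S k => let (a, b) := Cantor.of_nat n in Cantor.of_nat a :: dec k b
    end).
  assert (HdecS : forall k n, dec (S k) n =
    let (a, b) := Cantor.of_nat n in Cantor.of_nat a :: dec k b) by reflexivity.
  assert (Hdec : forall l, exists n, dec (length l) n = l).
  { induction l as [|p l [n Hn]]; [exists O; auto|].
    exists (Cantor.to_nat (Cantor.to_nat p, n)); cbn [length]; rewrite HdecS.
    now rewrite !Cantor.cancel_of_to, Hn. }
  pose (graph (l : list (nat * nat)) (f : IN) :=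
    forall x y, app f x = Some y <-> In (x, y) l).
  assert (He : forall j, exists f, let (k, n) := Cantor.of_nat j in
            (exists f, graph (dec k n) f) -> graph (dec k n) f).
  { intros j; destruct (Cantor.of_nat j) as [k n].
    destruct (classic (exists f, graph (dec k n) f)) as [[f Hf]|H]; eauto.
    exists (one (fun _ => True)); tauto. }
  pose (e j := proj1_sig (constructive_indefinite_description _ (He j))).
  exists (fun f => exists j, e j = f); split; [exists e; auto|].
  intros U HU [f Hf]; rewrite tau_pp_iff in HU.
  destruct (HU f Hf) as [k Hk].
  (* The part of [f] that [agree k] can see. It is finite because each m < k contributes at most one
     pair as an argument and, [f] being injective, one as a value. *)
  pose (P x y := app f x = Some y /\ (x < k \/ y < k)%nat).
  assert (Hl : exists l, forall x y, P x y <-> In (x, y) l).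
  { assert (H : forall m, exists l, forall x y,
      app f x = Some y /\ (x < m \/ y < m)%nat <-> In (x, y) l).
    { induction m as [|m [l Hl]].
      { exists nil; intros x y; simpl; split; [lia|tauto]. }
      exists ((match app f m with Some y => (m, y) :: nil | None => nil end) ++
              (match app (inv f) m with Some x => (x, m) :: nil | None => nil end) ++ l).
      intros x y; rewrite !in_app_iff, <- Hl; split.
      - intros [Hxy Hm]; destruct (Nat.eq_dec x m) as [->|].
        { left; rewrite Hxy; simpl; auto. }
        destruct (Nat.eq_dec y m) as [->|].
        { right; left; rewrite <- app_inv in Hxy; rewrite Hxy; simpl; auto. }
        right; right; split; auto; lia.
      - intros [H|[H|[H H']]]; [| |split; auto; lia].
        + destruct (app f m) as [y'|] eqn:E; simpl in H; [|tauto].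
          destruct H as [H|[]]; injection H as <- <-; split; auto; lia.
        + destruct (app (inv f) m) as [x'|] eqn:E; simpl in H; [|tauto].
          destruct H as [H|[]]; injection H as <- <-; rewrite app_inv in E.
          split; auto; lia. }
    apply H. }
  destruct Hl as [l Hl]; destruct (Hdec l) as [n Hn].
  pose (g x := match app f x with
               | Some y => if excluded_middle_informative (P x y) then Some y else None
               | None => None end).
  assert (Hg : forall x y, g x = Some y <-> P x y).
  { intros x y; unfold g; split.
    - destruct (app f x) as [y'|] eqn:E; [|discriminate].
      destruct (excluded_middle_informative _); [|discriminate]; congruence.
    - intros H; pose proof H as [-> _].
      now destruct (excluded_middle_informative _). }
  assert (Hginj : pinj g).
  { intros x x' y Hx Hx'; apply Hg in Hx as [Hx _], Hx' as [Hx' _].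
    eapply app_inj; eauto. }
  set (j := Cantor.to_nat (length l, n)).
  exists (e j); split; [eauto|].
  assert (Hj : graph l (e j)).
  { unfold e; destruct (constructive_indefinite_description _ (He j)) as [h Hh].
    cbn [proj1_sig]; unfold j in Hh; rewrite Cantor.cancel_of_to, Hn in Hh; apply Hh.
    exists (exist _ g Hginj); intros x y; simpl; now rewrite Hg. }
  apply Hk; intros x Hx; split; apply option_ext; intros y.
  - rewrite (Hj x y), <- Hl; unfold P; intuition.
  - rewrite !app_inv, (Hj y x), <- Hl; unfold P; intuition.
Qed.

(** * Semigroup operations, idempotents and restrictions in [tau_pp] *)

Lemma bounded_values (h : nat -> option nat) (k : nat) :
  exists m, (k <= m)%nat /\ forall x y, (x < k)%nat -> h x = Some y -> (y < m)%nat.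
Proof.
  enough (H : forall j, exists m, (k <= m)%nat /\
            forall x y, (x < j)%nat -> h x = Some y -> (y < m)%nat) by auto.
  induction j as [|j [m [Hm H]]]; [exists k; split; auto; intros; lia|].
  exists (m + match h j with Some y => S y | None => O end)%nat.
  split; [lia|]; intros x y Hx Hy; destruct (Nat.eq_dec x j) as [->|].
  - rewrite Hy; lia.
  - specialize (H x y ltac:(lia) Hy); lia.
Qed.

(** Below [k], the composite reads [f] only at the values of [g] there, which are bounded. The
    inverse is again a composite, in reverse order; allowing any [m'] above [m] lets one maximum
    serve both. *)
Lemma agree_comp (f g : IN) (k : nat) :
  exists m, forall f' g', agree m f f' -> agree m g g' ->
    agree k (comp f g) (comp f' g').
Proof.
  assert (H : forall f g : IN, exists m, forall m' f' g', (m <= m')%nat ->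
    agree m' f f' -> agree m' g g' -> forall x, (x < k)%nat ->
      app (comp f g) x = app (comp f' g') x).
  { clear; intros f g; destruct (bounded_values (app g) k) as [m [Hm Hb]].
    exists m; intros m' f' g' Hle Hf Hg x Hx; simpl; unfold comp_fun.
    destruct (Hg x) as [<- _]; [lia|].
    destruct (app g x) as [y|] eqn:E; auto.
    apply Hf; specialize (Hb x y Hx E); lia. }
  destruct (H f g) as [m1 H1], (H (inv g) (inv f)) as [m2 H2].
  exists (max m1 m2); intros f' g' Hf Hg x Hx; split.
  - apply (H1 (max m1 m2)); auto; lia.
  - rewrite !inv_comp; apply (H2 (max m1 m2)); auto using agree_inv; lia.
Qed.

Lemma top_inverse_semigroup_tau_pp : top_inverse_semigroup tau_pp.
Proof.
  split.
  - intros U HU; apply prod_top_iff; try apply is_topology_generated.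
    intros f g Hfg; rewrite tau_pp_iff in HU; destruct (HU _ Hfg) as [k Hk].
    destruct (agree_comp f g k) as [m Hm].
    exists (agree m f), (agree m g); simpl.
    repeat split; auto using tau_pp_cylinder, agree_refl; apply H.
  - intros U HU; rewrite tau_pp_iff in *; intros f Hf.
    destruct (HU _ Hf) as [k Hk]; exists k; auto using agree_inv.
Qed.

Lemma agree_one (k : nat) (A B : nat -> Prop) :
  (forall x, (x < k)%nat -> (A x <-> B x)) <-> agree k (one A) (one B).
Proof.
  split.
  - intros H x Hx; rewrite !inv_one; split; apply option_ext; intros y;
      rewrite !app_one, (H x Hx); tauto.
  - intros H x Hx; destruct (H x Hx) as [E _].
    pose proof (app_one A x x); pose proof (app_one B x x); rewrite E in *; tauto.
Qed.

(* Koenig's lemma: a bad cover stays bad along a branch of cylinders. *)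
Lemma compact_idempotents_tau_pp : compact_in tau_pp idempotents.
Proof.
  intros F HF Hcov; apply NNPP; intros Hno.
  pose (bad k A := ~ exists l, (forall U, In U l -> F U) /\
    forall B, agree k (one A) (one B) -> exists U, In U l /\ U (one B)).
  pose (St := { p : nat * (nat -> Prop) | bad (fst p) (snd p) }).
  pose (step (_ : nat) (s s' : St) :=
    fst (proj1_sig s') = S (fst (proj1_sig s)) /\
    agree (fst (proj1_sig s)) (one (snd (proj1_sig s))) (one (snd (proj1_sig s')))).
  assert (H0 : bad O (fun _ => True)).
  { intros [l [Hl Hl']]; apply Hno; exists l; split; auto.
    intros f [A ->]; apply Hl'; intros x Hx; lia. }
  destruct (dependent_choice step (exist _ (O, fun _ => True) H0)) as [u [Hu0 Hu]].
  { intros n [[k A] Hbad]; apply NNPP; intros Hs; apply Hbad.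
    (* The cylinder splits in two according to whether [k] is a member, as [P] prescribes; finite
       subcovers of both halves would join to one of the whole. *)
    assert (HP : forall P : Prop, ~ bad (S k) (fun x => if Nat.eq_dec x k then P else A x)).
    { intros P HP; apply Hs; exists (exist _ (S k, _) HP); split; auto; simpl.
      apply agree_one; intros x Hx; destruct (Nat.eq_dec x k); [lia|tauto]. }
    pose proof (NNPP _ (HP True)) as [l1 [Hl1 H1]].
    pose proof (NNPP _ (HP False)) as [l2 [Hl2 H2]].
    exists (l1 ++ l2); split.
    { intros U HU; apply in_app_iff in HU as [|]; auto. }
    intros B HB; simpl fst in *; simpl snd in *; rewrite <- agree_one in HB.
    destruct (classic (B k)) as [Hk|Hk].
    - destruct (H1 B) as [U [HU HB']]; [|exists U; rewrite in_app_iff; auto].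
      apply agree_one; intros x Hx; destruct (Nat.eq_dec x k) as [->|]; [tauto|].
      apply HB; lia.
    - destruct (H2 B) as [U [HU HB']]; [|exists U; rewrite in_app_iff; auto].
      apply agree_one; intros x Hx; destruct (Nat.eq_dec x k) as [->|]; [tauto|].
      apply HB; lia. }
  pose (A n := snd (proj1_sig (u n))).
  assert (Hfst : forall n, fst (proj1_sig (u n)) = n).
  { induction n as [|n IH]; [now rewrite Hu0|].
    destruct (Hu n) as [-> _]; congruence. }
  (* Membership of [x] is settled from stage [S x] on, so the diagonal of the branch is its
     limit. *)
  assert (HA : forall n x, (x < n)%nat -> A n x <-> A (S x) x).
  { induction n as [|n IH]; intros x Hx; [lia|].
    destruct (Nat.eq_dec x n) as [->|]; [tauto|].
    rewrite <- IH by lia; destruct (Hu n) as [_ H]; rewrite Hfst in H.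
    rewrite <- agree_one in H; symmetry; apply H; lia. }
  destruct (Hcov (one (fun x => A (S x) x))) as [U [HU HUA]]; [eexists; eauto|].
  pose proof (HF U HU) as HUo; rewrite tau_pp_iff in HUo.
  destruct (HUo _ HUA) as [k Hk].
  pose proof (proj2_sig (u k)) as Hbad; cbv beta in Hbad; rewrite Hfst in Hbad.
  apply Hbad; exists (U :: nil); split.
  { intros V [<-|[]]; auto. }
  intros B HB; exists U; split; [simpl; auto|].
  apply Hk; eapply agree_trans; [|exact HB].
  apply agree_one; intros x Hx; symmetry; now apply HA.
Qed.

(* An [h] in [R_set A] near the restriction of [f] is extended by the part of
   [f] outside [A] that is visible below [k]. *)
Lemma restriction_lift (A : nat -> Prop) (f : IN) (k : nat) :
  exists m, forall h, agree m (comp f (one A)) h -> R_set A h ->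
    exists f', agree k f f' /\ h = comp f' (one A).
Proof.
  (* Every pair to be added has its value below [m], where [h] and the restriction of [f] have the
     same preimages; hence no added pair can collide with one of [h]. *)
  destruct (bounded_values (app f) k) as [m [Hm Hb]].
  exists m; intros h Hh [h0 Eh].
  assert (HhA : forall x y, app h x = Some y -> A x).
  { intros x y Hxy; rewrite Eh in Hxy; now apply app_comp_one in Hxy. }
  assert (Hdom : forall x y, (x < m)%nat -> app h x = Some y <-> A x /\ app f x = Some y).
  { intros x y Hx; destruct (Hh x Hx) as [<- _]; apply app_comp_one. }
  assert (Him : forall x y, (y < m)%nat -> app h x = Some y <-> A x /\ app f x = Some y).
  { intros x y Hy; rewrite <- app_inv; destruct (Hh y Hy) as [_ <-].
    rewrite app_inv; apply app_comp_one. }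
  pose (P x y := app h x = Some y \/
                 (~ A x /\ app f x = Some y /\ (x < k \/ y < k)%nat)).
  assert (HPm : forall x y, ~ A x -> P x y -> (y < m)%nat).
  { intros x y Hx [H|[_ [H [H'|H']]]]; [apply HhA in H; tauto|eauto|lia]. }
  assert (HP1 : forall x y y', P x y -> P x y' -> y = y').
  { intros x y y' [H|[H1 [H2 _]]] [H'|[H1' [H2' _]]]; try congruence;
      [apply HhA in H|apply HhA in H']; tauto. }
  assert (HP2 : forall x x' y, P x y -> P x' y -> x = x').
  { intros x x' y H H'; destruct (classic (A x /\ A x')) as [HA|HA].
    - destruct H as [H|H]; [|tauto]; destruct H' as [H'|H']; [|tauto].
      eapply app_inj; eauto.
    - assert (Hy : (y < m)%nat).
      { destruct (classic (A x)); [apply (HPm x')|apply (HPm x)]; tauto. }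
      assert (app f x = Some y) by (destruct H as [H|H]; [apply Him in H|]; tauto).
      assert (app f x' = Some y) by (destruct H' as [H'|H']; [apply Him in H'|]; tauto).
      eapply app_inj; eauto. }
  pose (F x := match excluded_middle_informative (exists y, P x y) with
               | left H => Some (proj1_sig (constructive_indefinite_description _ H))
               | right _ => None end).
  assert (HF : forall x y, F x = Some y <-> P x y).
  { intros x y; unfold F; destruct (excluded_middle_informative _) as [H|H].
    - destruct (constructive_indefinite_description _ H) as [y' Hy']; simpl; split.
      + intros E; congruence.
      + intros Hy; f_equal; eauto.
    - split; [discriminate|intros Hy; destruct H; eauto]. }
  assert (HFinj : pinj F).
  { intros x x' y Hx Hx'; apply HF in Hx, Hx'; eauto. }
  assert (Hnear : forall x y, (x < k \/ y < k)%nat -> app f x = Some y <-> P x y).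
  { intros x y Hxy; unfold P; assert (Hm' : (x < m \/ y < m)%nat) by lia.
    assert (Hh' : app h x = Some y <-> A x /\ app f x = Some y)
      by (destruct Hm'; auto).
    rewrite Hh'; tauto. }
  exists (exist _ F HFinj); split.
  - intros x Hx; split; apply option_ext; intros y.
    + simpl app; rewrite HF; apply Hnear; auto.
    + rewrite !app_inv; simpl app; rewrite HF; apply Hnear; auto.
  - apply IN_ext; intros x y; rewrite app_comp_one; simpl app; rewrite HF.
    unfold P; split; [|tauto]; intros Hxy; split; eauto.
Qed.

Lemma r_open_tau_pp (A : nat -> Prop) : r_open tau_pp A.
Proof.
  (* The union of all cylinders whose trace on [R_set A] lies in the image of [U]. *)
  intros U HU; exists (fun h => exists m, forall h', agree m h h' -> R_set A h' ->
    exists f, U f /\ h' = comp f (one A)); split.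
  - apply tau_pp_iff; intros h [m Hm]; exists m; intros h' Hh'; exists m.
    intros h'' Hh''; apply Hm; eapply agree_trans; eauto.
  - intros h; split.
    + intros [f [Hf ->]]; split; [|eexists; eauto].
      rewrite tau_pp_iff in HU; destruct (HU f Hf) as [k Hk].
      destruct (restriction_lift A f k) as [m Hm]; exists m; intros h' Hh' HA.
      destruct (Hm h' Hh' HA) as [f' [Hf' E]]; eauto.
    + intros [[m Hm] HA]; apply Hm; auto using agree_refl.
Qed.

Lemma good_topology_tau_pp : good_topology tau_pp.
Proof.
  assert (Ht : is_topology tau_pp) by apply is_topology_generated.
  split; [auto|]; split; [|split; [|split]].
  - split; [auto|]; split; [apply separable_tau_pp|].
    exists pp_dist; auto using pp_dist_metric, pp_dist_complete, metric_top_pp_dist.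
  - apply top_inverse_semigroup_tau_pp.
  - apply compact_idempotents_tau_pp.
  - apply r_open_tau_pp.
Qed.

(** * Uniqueness *)

Lemma continuous_metric_cont {T : Type} (O : (T -> Prop) -> Prop) (d : T -> T -> R)
  (F : T -> T) :
  is_metric d -> (forall U, O U <-> metric_top d U) -> continuous O O F ->
  metric_cont d d F.
Proof.
  intros Hd HO HF x eps Heps.
  assert (HU : O (fun y => d (F x) y < eps)) by now apply HO, metric_top_ball.
  apply HF, HO in HU; apply HU; now rewrite metric_refl.
Qed.

Lemma continuous_metric_cont2 {T : Type} (O : (T -> Prop) -> Prop) (d : T -> T -> R)
  (m : T -> T -> T) :
  is_metric d -> (forall U, O U <-> metric_top d U) ->
  continuous (prod_top O O) O (fun p => m (fst p) (snd p)) ->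
  metric_cont2 d m.
Proof.
  intros Hd HO Hm x y eps Heps.
  assert (Ht : is_topology O).
  { apply (is_topology_ext (metric_top d)); auto using is_topology_metric_top.
    intros U; symmetry; auto. }
  assert (HU : O (fun z => d (m x y) z < eps)) by now apply HO, metric_top_ball.
  apply Hm in HU; rewrite prod_top_iff in HU by auto.
  destruct (HU x y) as [U [V [HU1 [HV [Hx [Hy H]]]]]].
  { simpl; now rewrite metric_refl. }
  rewrite HO in HU1, HV.
  destruct (HU1 x Hx) as [e1 [He1 H1]], (HV y Hy) as [e2 [He2 H2]].
  destruct (pos_below e1 e2 1) as [r [Hr [? [? _]]]]; try lra.
  exists r; split; auto; intros x' y' Hx' Hy'; apply (H x' y'); [apply H1|apply H2]; lra.
Qed.

Section InverseSemigroupMetric.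
Context (d : IN -> IN -> R) (Hd : is_metric d)
  (Hcomp : metric_cont2 d comp) (Hinv : metric_cont d d inv).

Lemma metric_cont_neq_open (F : IN -> IN) (c : IN) :
  metric_cont d d F -> metric_top d (fun f => F f <> c).
Proof.
  intros HF; apply (metric_top_preimage d d F (fun g => g <> c) HF).
  now apply metric_top_neq.
Qed.

(** The word 1_{y} f 1_{x} is the empty map unless f(x) = y. As f^-1 f and f f^-1 are the identities
    of the domain and the image, f^-1 f 1_{x} = 1_{x} says that [x] is in the domain, and dually for
    the image. Words are continuous and points are closed, so inequations define open sets. *)
Lemma tau_pp_coarser (U : IN -> Prop) : tau_pp U -> metric_top d U.
Proof.
  assert (Hid := metric_cont_id d).
  intros HU; apply HU; [apply is_topology_metric_top|].
  intros V [[x [y ->]]|[[x ->]|[y ->]]].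
  - replace (v_set x y) with (fun f =>
      comp (one (eq y)) (comp f (one (eq x))) <> one (fun _ => False)).
    { apply metric_cont_neq_open; auto using metric_cont2_comp, metric_cont_const. }
    apply pred_ext; intros f; unfold v_set; split.
    + intros H; apply NNPP; intros Hxy; apply H, IN_ext; intros x' y'.
      rewrite app_comp, app_one; split; [|tauto].
      intros [z [Hz Hy]]; apply app_comp_one in Hz as [<- Hz].
      apply app_one in Hy as [<- ->]; contradiction.
    + intros H E.
      assert (Hxy : app (comp (one (eq y)) (comp f (one (eq x)))) x = Some y).
      { apply app_comp; exists y; rewrite app_comp_one, app_one; auto. }
      rewrite E in Hxy; now apply app_one in Hxy.
  - replace (w1_set x) with (fun f =>
      comp (comp (inv f) f) (one (eq x)) <> one (eq x)).
    { apply metric_cont_neq_open; auto using metric_cont2_comp, metric_cont_const. }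
    apply pred_ext; intros f; unfold w1_set; split.
    + intros H; destruct (app f x) as [y|] eqn:Hxy; auto; destruct H.
      apply IN_ext; intros x' y'; rewrite app_comp_one, app_comp, app_one; split.
      * intros [<- [z [Hz Hy]]]; rewrite app_inv in Hy.
        split; auto; eapply app_inj; eauto.
      * intros [<- ->]; split; auto; exists y; now rewrite app_inv.
    + intros H E.
      assert (Hx : app (one (eq x)) x = Some x) by now apply app_one.
      rewrite <- E in Hx; apply app_comp_one in Hx as [_ Hx].
      apply app_comp in Hx as [z [Hz _]]; congruence.
  - replace (w2_set y) with (fun f =>
      comp (comp f (inv f)) (one (eq y)) <> one (eq y)).
    { apply metric_cont_neq_open; auto using metric_cont2_comp, metric_cont_const. }
    apply pred_ext; intros f; unfold w2_set; split.
    + intros H [x Hxy]; apply H.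
      apply IN_ext; intros x' y'; rewrite app_comp_one, app_comp, app_one; split.
      * intros [<- [z [Hz Hy]]]; rewrite app_inv in Hz.
        split; auto; congruence.
      * intros [<- ->]; split; auto; exists x; now rewrite app_inv.
    + intros H E; apply H.
      assert (Hy : app (one (eq y)) y = Some y) by now apply app_one.
      rewrite <- E in Hy; apply app_comp_one in Hy as [_ Hy].
      apply app_comp in Hy as [z [_ Hz]]; eauto.
Qed.

Lemma metric_cont_pp_dist : metric_cont d pp_dist (fun f => f).
Proof.
  intros f eps Heps.
  assert (HU := tau_pp_coarser (fun g => pp_dist f g < eps)).
  rewrite metric_top_pp_dist in HU.
  apply HU; [apply metric_top_ball|rewrite metric_refl]; auto using pp_dist_metric.
Qed.
End InverseSemigroupMetric.

(** * The group of units and the Halmos dilation *)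

(** These are the permutations of the naturals. Equations between words make the set closed under
    limits in [units_dist_complete]. *)
Definition is_unit (f : IN) : Prop :=
  comp f (inv f) = one (fun _ => True) /\ comp (inv f) f = one (fun _ => True).

Lemma one_comp (f : IN) : comp (one (fun _ => True)) f = f.
Proof.
  apply IN_ext; intros x y; rewrite app_comp; split.
  - intros [z [Hz Hy]]; apply app_one in Hy as [_ ->]; auto.
  - intros H; exists y; rewrite app_one; auto.
Qed.

Lemma comp_one (f : IN) : comp f (one (fun _ => True)) = f.
Proof. apply IN_ext; intros x y; rewrite app_comp_one; tauto. Qed.

Lemma is_unit_one : is_unit (one (fun _ => True)).
Proof. split; rewrite inv_one; apply one_comp. Qed.

Lemma is_unit_inv f : is_unit f -> is_unit (inv f).
Proof. intros [H1 H2]; split; now rewrite inv_inv. Qed.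

Lemma is_unit_comp f g : is_unit f -> is_unit g -> is_unit (comp f g).
Proof.
  intros [H1 H2] [H3 H4]; split; rewrite inv_comp.
  - now rewrite comp_assoc, <- (comp_assoc f g), H3, comp_one.
  - now rewrite comp_assoc, <- (comp_assoc _ (inv f)), H2, comp_one.
Qed.

Definition units : Type := { f : IN | is_unit f }.

Lemma units_ext (f g : units) : proj1_sig f = proj1_sig g -> f = g.
Proof.
  destruct f as [f Hf], g as [g Hg]; simpl; intros ->; f_equal; apply proof_irrelevance.
Qed.

Definition units_one : units := exist _ _ is_unit_one.
Definition units_inv (f : units) : units := exist _ _ (is_unit_inv _ (proj2_sig f)).
Definition units_comp (f g : units) : units :=
  exist _ _ (is_unit_comp _ _ (proj2_sig f) (proj2_sig g)).
Definition units_dist (d : IN -> IN -> R) (f g : units) : R :=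
  d (proj1_sig f) (proj1_sig g).

Lemma units_dist_metric d : is_metric d -> is_metric (units_dist d).
Proof.
  intros [H1 [H2 [H3 H4]]]; unfold units_dist; repeat split; auto.
  - intros H; apply units_ext; now apply H2.
  - intros ->; now apply H2.
Qed.

Lemma units_dist_complete d :
  is_metric d -> metric_cont2 d comp -> metric_cont d d inv ->
  metric_complete d -> metric_complete (units_dist d).
Proof.
  intros Hd Hcomp Hinv Hc u Hu.
  destruct (Hc (fun n => proj1_sig (u n)) Hu) as [l Hl].
  assert (Hclosed : forall F : IN -> IN, metric_cont d d F ->
    (forall f, is_unit f -> F f = one (fun _ => True)) -> F l = one (fun _ => True)).
  { intros F HF Hunit; apply NNPP; intros Hne.
    destruct (metric_cont_neq_open d Hd F (one (fun _ => True)) HF l Hne)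
      as [eps [Heps H]].
    destruct (Hl eps Heps) as [N HN]; specialize (HN N (Nat.le_refl N)).
    rewrite metric_sym in HN by auto.
    apply (H _ HN), Hunit, (proj2_sig (u N)). }
  assert (Hlu : is_unit l).
  { split; [apply (Hclosed (fun f => comp f (inv f)))
           |apply (Hclosed (fun f => comp (inv f) f))];
      auto using metric_cont2_comp, metric_cont_id;
      intros f Hf; apply Hf. }
  now exists (exist _ l Hlu).
Qed.

(** [d] is the finer metric [d1] of [group_open_mapping] by [metric_cont_pp_dist]; Baire's theorem
    is applied to [pp_dist]. The dense sequence given by [O] is first moved into the units. *)
Lemma units_identity_open (O : (IN -> Prop) -> Prop) (d : IN -> IN -> R) :
  is_metric d -> metric_complete d -> (forall U, O U <-> metric_top d U) ->
  separable O -> metric_cont2 d comp -> metric_cont d d inv ->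
  metric_cont (units_dist pp_dist) (units_dist d) (fun f => f).
Proof.
  intros Hd Hc HO [D [[e He] HD]] Hcomp Hinv.
  assert (He' : forall f eps, 0 < eps -> exists n, d f (e n) < eps).
  { intros f eps Heps; destruct (HD (fun g => d f g < eps)) as [g [Hg Hfg]].
    - now apply HO, metric_top_ball.
    - exists f; now rewrite metric_refl.
    - destruct (He g Hg) as [n <-]; eauto. }
  destruct (subspace_dense_seq d Hd e is_unit units_one He') as [q Hq].
  destruct top_inverse_semigroup_tau_pp as [Hm Hi].
  apply continuous_metric_cont2 with (d := pp_dist) in Hm;
    auto using pp_dist_metric, metric_top_pp_dist.
  apply continuous_metric_cont with (d := pp_dist) in Hi;
    auto using pp_dist_metric, metric_top_pp_dist.
  apply (group_open_mapping units_comp units_inv units_one _ _ q);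
    auto using units_dist_metric, units_dist_complete, pp_dist_metric, pp_dist_complete.
  - intros x y z; apply units_ext, comp_assoc.
  - intros x; apply units_ext, one_comp.
  - intros x; apply units_ext, comp_one.
  - intros x; apply units_ext, (proj2_sig x).
  - intros x; apply units_ext, (proj2_sig x).
  - intros x y eps Heps.
    destruct (Hcomp (proj1_sig x) (proj1_sig y) eps Heps) as [r [Hr H]].
    exists r; split; auto; intros x' y'; apply H.
  - intros x eps Heps; destruct (Hinv (proj1_sig x) eps Heps) as [r [Hr H]].
    exists r; split; auto; intros y; apply H.
  - intros x y eps Heps.
    destruct (Hm (proj1_sig x) (proj1_sig y) eps Heps) as [r [Hr H]].
    exists r; split; auto; intros x' y'; apply H.
  - intros x eps Heps.
    destruct (metric_cont_pp_dist d Hd Hcomp Hinv (proj1_sig x) eps Heps)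
      as [r [Hr H]].
    exists r; split; auto; intros y; apply H.
Qed.

(* The permutation matrix [[s, 1 - s s^-1], [1 - s^-1 s, s^-1]] acting on two
   copies of the naturals, the evens and the odds (Halmos dilation). *)
Definition dilation_fun (s : IN) (n : nat) : nat :=
  let x := Nat.div2 n in
  if Nat.even n
  then match app s x with Some y => 2 * y | None => 2 * x + 1 end
  else match app (inv s) x with Some y => 2 * y + 1 | None => 2 * x end.

Lemma dilation_fun_even (s : IN) x :
  dilation_fun s (2 * x) = match app s x with Some y => 2 * y | None => 2 * x + 1 end%nat.
Proof.
  unfold dilation_fun; rewrite Nat.div2_double.
  now replace (Nat.even (2 * x)) with true by (symmetry; apply Nat.even_spec; eexists; eauto).
Qed.

Lemma dilation_fun_odd (s : IN) x :
  dilation_fun s (2 * x + 1) =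
  match app (inv s) x with Some y => 2 * y + 1 | None => 2 * x end%nat.
Proof.
  unfold dilation_fun; rewrite Nat.add_1_r, Nat.div2_succ_double.
  replace (Nat.even (S (2 * x))) with false; auto.
  now rewrite Nat.even_succ, Nat.odd_even.
Qed.

(** A permutation matrix is inverted by transposing it, and here this exchanges [s] with its
    inverse. *)
Lemma dilation_fun_inv (s : IN) n : dilation_fun (inv s) (dilation_fun s n) = n.
Proof.
  destruct (Nat.Even_or_Odd n) as [[x ->]|[x ->]].
  - rewrite dilation_fun_even; destruct (app s x) as [y|] eqn:E.
    + rewrite dilation_fun_even; rewrite <- app_inv in E; now rewrite E.
    + rewrite dilation_fun_odd, inv_inv; now rewrite E.
  - rewrite dilation_fun_odd; destruct (app (inv s) x) as [y|] eqn:E.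
    + rewrite dilation_fun_odd, inv_inv; rewrite app_inv in E; now rewrite E.
    + rewrite dilation_fun_even; now rewrite E.
Qed.

Lemma dilation_pinj (s : IN) : pinj (fun n => Some (dilation_fun s n)).
Proof.
  intros m n z Hm Hn; rewrite <- (dilation_fun_inv s m), <- (dilation_fun_inv s n).
  congruence.
Qed.

Definition dilation (s : IN) : IN := exist _ _ (dilation_pinj s).

Lemma app_dilation (s : IN) n : app (dilation s) n = Some (dilation_fun s n).
Proof. reflexivity. Qed.

Lemma inv_dilation (s : IN) : inv (dilation s) = dilation (inv s).
Proof.
  apply IN_ext; intros m n; rewrite app_inv, !app_dilation; split; intros E.
  - injection E as <-; now rewrite dilation_fun_inv.
  - injection E as <-; f_equal.
    now rewrite <- (inv_inv s) at 1; rewrite dilation_fun_inv.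
Qed.

Lemma dilation_unit (s : IN) : is_unit (dilation s).
Proof.
  assert (H : forall t, comp (dilation (inv t)) (dilation t) = one (fun _ => True)).
  { intros t; apply IN_ext; intros x y; rewrite app_comp, app_one; split.
    - intros [z [Hz Hy]]; rewrite app_dilation in *; split; auto.
      injection Hz as <-; injection Hy as <-; apply dilation_fun_inv.
    - intros [_ ->]; exists (dilation_fun t x); rewrite !app_dilation.
      now rewrite dilation_fun_inv. }
  split; rewrite inv_dilation; auto.
  rewrite <- (inv_inv s) at 1; apply H.
Qed.

(** The value at [n] consults [s] and its inverse only at [Nat.div2 n], which is at most [n], so [k]
    is preserved. *)
Lemma agree_dilation k (s t : IN) : agree k s t -> agree k (dilation s) (dilation t).
Proof.
  intros H.
  assert (Hfun : forall s t, agree k s t -> forall n, (n < k)%nat ->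
    dilation_fun s n = dilation_fun t n).
  { clear; intros s t H n Hn; unfold dilation_fun.
    destruct (H (Nat.div2 n)) as [-> ->]; auto.
    pose proof (Nat.le_div2_diag_l n); lia. }
  intros n Hn; rewrite !inv_dilation, !app_dilation; split; f_equal; auto using agree_inv.
Qed.

Lemma even_pinj : pinj (fun x => Some (2 * x)%nat).
Proof. intros x y z Hx Hy; injection Hx; injection Hy; lia. Qed.

Definition even_embedding : IN := exist _ _ even_pinj.

(** Compressing to the even copy extracts the corner [s] of the matrix: points outside the domain
    are sent to odd numbers, outside the image of [even_embedding]. *)
Lemma compression_dilation (s : IN) :
  comp (inv even_embedding) (comp (dilation s) even_embedding) = s.
Proof.
  apply IN_ext; intros x y; rewrite app_comp.
  assert (H : forall z, app (comp (dilation s) even_embedding) x = Some z <->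
                dilation_fun s (2 * x) = z).
  { intros z; rewrite app_comp; split.
    - intros [w [Hw Hz]]; injection Hw as <-; now injection Hz.
    - intros <-; exists (2 * x)%nat; split; reflexivity. }
  split.
  - intros [z [Hz Hy]]; apply H in Hz; rewrite app_inv in Hy; injection Hy as <-.
    rewrite dilation_fun_even in Hz; destruct (app s x); [f_equal; lia|lia].
  - intros E; exists (2 * y)%nat; rewrite H, dilation_fun_even, E, app_inv; auto.
Qed.

Theorem theorem6p6 :
  good_topology tau_pp /\
  (forall O : (IN -> Prop) -> Prop, good_topology O ->
     forall U : IN -> Prop, O U <-> tau_pp U).
Proof.
  split; [apply good_topology_tau_pp|].
  intros O [_ [[_ [Hsep [d [Hd [Hc HO]]]]] [[Hcomp Hinv] _]]] U.
  apply (continuous_metric_cont2 O d) in Hcomp; auto.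
  apply (continuous_metric_cont O d) in Hinv; auto.
  rewrite HO; split; [|now apply tau_pp_coarser].
  intros HU; apply tau_pp_iff; intros s Hs.
  set (compress := fun t => comp (inv even_embedding) (comp t even_embedding)).
  assert (HV : metric_top d (fun t => U (compress t))).
  { apply (metric_top_preimage d d compress U); auto.
    apply metric_cont2_comp; auto using metric_cont_const.
    apply metric_cont2_comp; auto using metric_cont_const, metric_cont_id. }
  destruct (HV (dilation s)) as [eps [Heps H]].
  { unfold compress; now rewrite compression_dilation. }
  (* For arbitrary [s] and [t] no such estimate is available yet, but their dilations are both
     permutations. *)
  destruct (units_identity_open O d Hd Hc HO Hsep Hcomp Hinv
              (exist _ _ (dilation_unit s)) eps Heps) as [delta [Hdelta H']].
  destruct (inv_S_below delta Hdelta) as [k Hk]; exists (S k); intros t Ht.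
  rewrite <- (compression_dilation t); apply H.
  apply (H' (exist _ _ (dilation_unit t))); unfold units_dist; simpl proj1_sig.
  apply agree_dilation, pp_dist_lt in Ht; lra.
Qed.
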